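(* Let $\mathscr{A}=(a_{ijkl})\in\mathbb{T}_{4,3}$ be a paired symmetric tensor. Then the polynomial $\mathscr{A}x^2y^2$ is positive definite if and only if one of the following holds: (i) the matrix $A_{11}$ is positive definite, and for all $y\in\mathbb{R}^3\setminus\{0\}$, $(y^\top A_{11}y)(y^\top A_{22}y)-(y^\top A_{12}y)(y^\top A_{21}y)>0$ and $\det(A(y))>0$; (ii) the matrix $B_{11}$ is positive definite, and for all $x\in\mathbb{R}^3\setminus\{0\}$, $(x^\top B_{11}x)(x^\top B_{22}x)-(x^\top B_{12}x)(x^\top B_{21}x)>0$ and $\det(B(x))>0$. Furthermore, if $\mathscr{A}$ is an elasticity tensor, then conditions (i) and (ii) are the same.
   Context: $\mathbb{T}_{4,3}$ is the set of real tensors $\mathscr{A}=(a_{ijkl})$ with $i,j,k,l\in\{1,2,3\}$. $\mathscr{A}$ is paired symmetric if $a_{ijkl}=a_{jikl}=a_{ijlk}=a_{jilk}$ for all indices; it is an elasticity tensor if moreover $a_{ijkl}=a_{klij}$ for all indices. For $x,y\in\mathbb{R}^3$, $\mathscr{A}x^2y^2:=\sum_{i,j,k,l=1}^3a_{ijkl}x_ix_jy_ky_l$; this polynomial is positive definite if $\mathscr{A}x^2y^2>0$ for all $x,y\in\mathbb{R}^3\setminus\{0\}$. For $i,j\in\{1,2,3\}$, $A_{ij}\in\mathbb{R}^{3\times3}$ is the matrix whose $(k,l)$ entry is $a_{ijkl}$; for $k,l\in\{1,2,3\}$, $B_{kl}\in\mathbb{R}^{3\times 3}$ is the matrix whose $(i,j)$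 entry is $a_{ijkl}$. For $x,y\in\mathbb{R}^3$, $A(y)\in\mathbb{R}^{3\times3}$ has $(i,j)$ entry $y^\top A_{ij}y$, and $B(x)\in\mathbb{R}^{3\times 3}$ has $(k,l)$ entry $x^\top B_{kl}x$. *)

(* Defs.v *)
From mathcomp Require Import all_boot all_order all_algebra.
From mathcomp Require Import reals.
Set Implicit Arguments.
Unset Strict Implicit.
Unset Printing Implicit Defensive.
Import Order.TTheory GRing.Theory Num.Theory.
Local Open Scope ring_scope.

(* Indices range over 'I_3, so the mathematical indices 1, 2, 3 are 0, 1, 2. *)
Definition tensor43 (R : realType) := 'I_3 -> 'I_3 -> 'I_3 -> 'I_3 -> R.

Definition paired_symmetric (R : realType) (a : tensor43 R) : Prop :=
  forall i j k l : 'I_3,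
    [/\ a i j k l = a j i k l,
        a i j k l = a i j l k
      & a i j k l = a j i l k].

Definition elasticity_tensor (R : realType) (a : tensor43 R) : Prop :=
  paired_symmetric a /\ forall i j k l : 'I_3, a i j k l = a k l i j.

Definition biquadratic (R : realType) (a : tensor43 R) (x y : 'cV[R]_3) : R :=
  \sum_(i < 3) \sum_(j < 3) \sum_(k < 3) \sum_(l < 3)
    a i j k l * x i 0 * x j 0 * y k 0 * y l 0.

Definition biquadratic_posdef (R : realType) (a : tensor43 R) : Prop :=
  forall x y : 'cV[R]_3, x != 0 -> y != 0 -> 0 < biquadratic a x y.

Definition quadform (R : realType) (n : nat) (M : 'M[R]_n) (v : 'cV[R]_n) : R :=
  (v^T *m M *m v) 0 0.

Definition posdefmx (R : realType) (n : nat) (M : 'M[R]_n) : Prop :=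
  M^T = M /\ forall v : 'cV[R]_n, v != 0 -> 0 < quadform M v.

Definition sliceA (R : realType) (a : tensor43 R) (i j : 'I_3) : 'M[R]_3 :=
  \matrix_(k, l) a i j k l.

Definition sliceB (R : realType) (a : tensor43 R) (k l : 'I_3) : 'M[R]_3 :=
  \matrix_(i, j) a i j k l.

Definition matA (R : realType) (a : tensor43 R) (y : 'cV[R]_3) : 'M[R]_3 :=
  \matrix_(i, j) quadform (sliceA a i j) y.

Definition matB (R : realType) (a : tensor43 R) (x : 'cV[R]_3) : 'M[R]_3 :=
  \matrix_(k, l) quadform (sliceB a k l) x.

Definition conditionA (R : realType) (a : tensor43 R) : Prop :=
  posdefmx (sliceA a 0 0) /\
  forall y : 'cV[R]_3, y != 0 ->
    0 < quadform (sliceA a 0 0) y * quadform (sliceA a 1 1) y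
        - quadform (sliceA a 0 1) y * quadform (sliceA a 1 0) y
    /\ 0 < \det (matA a y).

Definition conditionB (R : realType) (a : tensor43 R) : Prop :=
  posdefmx (sliceB a 0 0) /\
  forall x : 'cV[R]_3, x != 0 ->
    0 < quadform (sliceB a 0 0) x * quadform (sliceB a 1 1) x
        - quadform (sliceB a 0 1) x * quadform (sliceB a 1 0) x
    /\ 0 < \det (matB a x).

(* Main.v *)
(** The form [biquadratic a x y] is, for fixed [y], the quadratic form of the
    symmetric matrix [matA a y] in [x] and, for fixed [x], that of [matB a x]
    in [y].  Condition (i) (resp. (ii)) is Sylvester's criterion applied to
    these matrices for every [y] (resp. every [x]).  For order 3, Sylvester's
    criterion follows from completing the square. *)
Require Import Defs.
From mathcomp Require Import all_boot all_order all_algebra.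
From mathcomp Require Import reals.
From mathcomp Require Import ring.
Set Implicit Arguments.
Unset Strict Implicit.
Unset Printing Implicit Defensive.
Import Order.TTheory GRing.Theory Num.Theory.
Local Open Scope ring_scope.

Lemma sum_ord3 (V : nmodType) (F : 'I_3 -> V) :
  \sum_(i < 3) F i = F 0 + F 1 + F 2.
Proof.
rewrite !big_ord_recl big_ord0 addr0 addrA.
by congr (F _ + F _ + F _); apply: val_inj.
Qed.

Lemma det_mx22 (R : comNzRingType) (M : 'M[R]_2) :
  \det M = M 0 0 * M 1 1 - M 0 1 * M 1 0.
Proof.
rewrite (expand_det_row _ 0) !big_ord_recl big_ord0 /cofactor !det_mx11 !mxE.
have -> : lift (0 : 'I_2) 0 = 1 by apply: val_inj.
have -> : lift (1 : 'I_2) 0 = 0 by apply: val_inj.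
by rewrite /=; ring.
Qed.

Lemma det_mx33 (R : comNzRingType) (M : 'M[R]_3) :
  \det M = M 0 0 * (M 1 1 * M 2 2 - M 1 2 * M 2 1)
         - M 0 1 * (M 1 0 * M 2 2 - M 1 2 * M 2 0)
         + M 0 2 * (M 1 0 * M 2 1 - M 1 1 * M 2 0).
Proof.
rewrite (expand_det_row _ 0) sum_ord3 /cofactor !det_mx22 !mxE.
have -> : lift (0 : 'I_3) 0 = 1 by apply: val_inj.
have -> : lift (0 : 'I_3) 1 = 2 by apply: val_inj.
have -> : lift (1 : 'I_3) 0 = 0 by apply: val_inj.
have -> : lift (1 : 'I_3) 1 = 2 by apply: val_inj.
have -> : lift (2 : 'I_3) 0 = 0 by apply: val_inj.
have -> : lift (2 : 'I_3) 1 = 1 by apply: val_inj.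
by rewrite /=; ring.
Qed.

Lemma quadformE (R : realType) (n : nat) (M : 'M[R]_n) (v : 'cV[R]_n) :
  quadform M v = \sum_i \sum_j M i j * v i 0 * v j 0.
Proof.
rewrite /quadform mxE exchange_big /=; apply: eq_bigr => j _.
rewrite mxE mulr_suml; apply: eq_bigr => i _.
by rewrite !mxE (mulrC (v i 0)).
Qed.

Lemma col3_eq0 (R : nmodType) (x : 'cV[R]_3) :
  x 0 0 = 0 -> x 1 0 = 0 -> x 2 0 = 0 -> x = 0.
Proof.
move=> x0 x1 x2; apply/colP => i; rewrite mxE.
by case: i => [[|[|[|//]]] hi]; [rewrite -x0 | rewrite -x1 | rewrite -x2];
  congr (x _ _); apply: val_inj.
Qed.

(** Completing the square twice and clearing denominators writes [p * D] times the form as [D * L ^+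
    2 + (D * x 1 0 + E * x 2 0) ^+ 2 + p * d * x 2 0 ^+ 2], where [p], [D], [d] are the leading
    principal minors. *)
Lemma sylvester3 (R : realType) (M : 'M[R]_3) : M^T = M ->
  (forall x : 'cV[R]_3, x != 0 -> 0 < quadform M x) <->
  [/\ 0 < M 0 0, 0 < M 0 0 * M 1 1 - M 0 1 * M 1 0 & 0 < \det M].
Proof.
move=> /matrixP symM.
have M10 : M 1 0 = M 0 1 by rewrite -symM mxE.
have M20 : M 2 0 = M 0 2 by rewrite -symM mxE.
have M21 : M 2 1 = M 1 2 by rewrite -symM mxE.
have qE x : quadform M x =
    M 0 0 * x 0 0 ^+ 2 + M 1 1 * x 1 0 ^+ 2 + M 2 2 * x 2 0 ^+ 2
    + 2 * (M 0 1 * x 0 0 * x 1 0 + M 0 2 * x 0 0 * x 2 0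
           + M 1 2 * x 1 0 * x 2 0).
  by rewrite quadformE !sum_ord3 M10 M20 M21; ring.
rewrite det_mx33 M10 M20 M21.
set p := M 0 0; set D := p * M 1 1 - _; set d := (X in [/\ _, _ & 0 < X]).
(* [E] is the minor on rows 0, 1 and columns 0, 2: the cross coefficient left once [x 0 0] has been
   eliminated. *)
pose E := p * M 1 2 - M 0 1 * M 0 2.
split=> [posM | [p0 D0 d0] x xN0].
  pose vec (a b c : R) : 'cV[R]_3 := \col_i [:: a; b; c]`_i.
  have q_vec a b c : quadform M (vec a b c) =
      p * a ^+ 2 + M 1 1 * b ^+ 2 + M 2 2 * c ^+ 2
      + 2 * (M 0 1 * a * b + M 0 2 * a * c + M 1 2 * b * c).
    by rewrite qE !mxE.
  have vecN0 a b c : [|| a != 0, b != 0 | c != 0] -> vec a b c != 0.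
    apply: contraTneq => /colP v0.
    by move: (v0 0) (v0 1) (v0 2); rewrite !mxE /= => -> -> ->; rewrite eqxx.
  have p0 : 0 < p.
    have := posM (vec 1 0 0) (vecN0 _ _ _ _).
    by rewrite q_vec oner_eq0 => /(_ isT); congr (0 < _); ring.
  (* The two test vectors below annihilate the leading squares of the
     completed-square identity used for the converse. *)
  have D0 : 0 < D.
    have := posM (vec (- M 0 1) p 0) (vecN0 _ _ _ _).
    rewrite q_vec (gt_eqF p0) orbT => /(_ isT).
    rewrite -(pmulr_rgt0 D p0); congr (0 < _); rewrite /D; ring.
  have pD0 : 0 < p * D by rewrite mulr_gt0.
  split=> //.
  have := posM (vec (M 0 1 * E - M 0 2 * D) (- E * p) (p * D)) (vecN0 _ _ _ _).
  rewrite q_vec (gt_eqF pD0) !orbT => /(_ isT).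
  (* Only the last square survives at this vector, so the form takes the value [p * (p * D) * d]
     there. *)
  rewrite -(pmulr_rgt0 d (mulr_gt0 p0 pD0)); congr (0 < _).
  rewrite /d /E /D; ring.
have pD0 : 0 < p * D by rewrite mulr_gt0.
rewrite -(pmulr_rgt0 _ pD0) qE -/p.
set L := p * x 0 0 + M 0 1 * x 1 0 + M 0 2 * x 2 0.
have -> : p * D * (p * x 0 0 ^+ 2 + M 1 1 * x 1 0 ^+ 2 + M 2 2 * x 2 0 ^+ 2
      + 2 * (M 0 1 * x 0 0 * x 1 0 + M 0 2 * x 0 0 * x 2 0
             + M 1 2 * x 1 0 * x 2 0))
    = D * L ^+ 2 + (D * x 1 0 + E * x 2 0) ^+ 2 + p * d * x 2 0 ^+ 2.
  by rewrite /L /d /E /D; ring.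
have pd0 : 0 < p * d by rewrite mulr_gt0.
have sq_gt0 (t : R) : t != 0 -> 0 < t ^+ 2 by rewrite exprn_even_gt0.
(* The last nonzero coordinate of [x] selects the strictly positive square: the third for [x 2 0],
   the second for [x 1 0], and [D * L ^+ 2] when only [x 0 0] remains. *)
have [x2 | x2N0] := eqVneq (x 2 0) 0; last first.
  rewrite ltr_wpDl ?addr_ge0 ?sqr_ge0 ?(mulr_ge0 (ltW D0)) ?sqr_ge0 //.
  by rewrite mulr_gt0 ?sq_gt0.
rewrite x2 expr0n !mulr0 !addr0.
have [x1 | x1N0] := eqVneq (x 1 0) 0; last first.
  rewrite ltr_wpDl ?(mulr_ge0 (ltW D0)) ?sqr_ge0 //.
  by rewrite sq_gt0 // mulf_neq0 // gt_eqF.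
rewrite /L x1 x2 !mulr0 expr0n !addr0 mulr_gt0 // sq_gt0 //.
rewrite mulf_neq0 ?(gt_eqF p0) //.
by apply: contra_neq xN0 => x0; apply: col3_eq0.
Qed.

Lemma biquadraticE (R : realType) (a : tensor43 R) (x y : 'cV[R]_3) :
  biquadratic a x y = quadform (matA a y) x.
Proof.
rewrite quadformE; apply: eq_bigr => i _; apply: eq_bigr => j _.
rewrite mxE quadformE -mulrA mulr_suml; apply: eq_bigr => k _.
rewrite mulr_suml; apply: eq_bigr => l _.
by rewrite mxE; ring.
Qed.

Lemma trmx_matA (R : realType) (a : tensor43 R) (y : 'cV[R]_3) :
  paired_symmetric a -> (matA a y)^T = matA a y.
Proof.
move=> ha; apply/matrixP => i j; rewrite !mxE; congr (quadform _ y).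
by apply/matrixP => k l; rewrite !mxE; case: (ha i j k l).
Qed.

Lemma trmx_sliceA (R : realType) (a : tensor43 R) (i j : 'I_3) :
  paired_symmetric a -> (sliceA a i j)^T = sliceA a i j.
Proof. by move=> ha; apply/matrixP => k l; rewrite !mxE; case: (ha i j k l). Qed.

(** The entry [matA a y 0 0] is the quadratic form of [sliceA a 0 0] at [y], so the first Sylvester
    inequality for all nonzero [y] is exactly positivity of that slice. Symmetry of [matA a y] comes
    from the first index pair, that of the slice from the second. *)
Lemma biquadratic_posdef_conditionA (R : realType) (a : tensor43 R) :
  paired_symmetric a -> biquadratic_posdef a <-> conditionA a.
Proof.
move=> ha; split=> [posa | [[_ posA] condA] x y xN0 yN0].
  have sylA y : y != 0 -> [/\ 0 < matA a y 0 0,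
      0 < matA a y 0 0 * matA a y 1 1 - matA a y 0 1 * matA a y 1 0
      & 0 < \det (matA a y)].
    move=> yN0; apply/sylvester3; first exact: trmx_matA.
    by move=> x xN0; rewrite -biquadraticE posa.
  split=> [|y /sylA[_]]; last by rewrite !mxE.
  split=> [|y /sylA[]]; first exact: trmx_sliceA.
  by rewrite mxE.
rewrite biquadraticE; move: x xN0; apply/sylvester3; first exact: trmx_matA.
have [? ?] := condA y yN0.
by split=> //; rewrite !mxE //; apply: posA.
Qed.

(* [sliceB], [matB] and [conditionB] of [a] are, definitionally, [sliceA],
   [matA] and [conditionA] of the following tensor. *)
Definition swap_pairs {R : realType} (a : tensor43 R) : tensor43 R :=
  fun k l i j => a i j k l.

Lemma paired_symmetric_swap (R : realType) (a : tensor43 R) :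
  paired_symmetric a -> paired_symmetric (swap_pairs a).
Proof. by move=> ha k l i j; case: (ha i j k l). Qed.

Lemma biquadratic_swap (R : realType) (a : tensor43 R) (x y : 'cV[R]_3) :
  biquadratic (swap_pairs a) y x = biquadratic a x y.
Proof. by rewrite /biquadratic /swap_pairs !sum_ord3; ring. Qed.

(** This is the previous criterion for [swap_pairs a]: swapping the pairs only exchanges the roles
    of [x] and [y], which both range over all nonzero vectors. *)
Lemma biquadratic_posdef_conditionB (R : realType) (a : tensor43 R) :
  paired_symmetric a -> biquadratic_posdef a <-> conditionB a.
Proof.
move=> /paired_symmetric_swap/biquadratic_posdef_conditionA.
apply: iff_trans.
by split=> posa x y xN0 yN0; [rewrite biquadratic_swap | rewrite -biquadratic_swap];
  apply: posa.
Qed.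

Theorem theorem4p2 (R : realType) (a : tensor43 R) (ha : paired_symmetric a) :
  (biquadratic_posdef a <-> conditionA a \/ conditionB a)
  /\ (elasticity_tensor a ->
        (forall i j : 'I_3, sliceA a i j = sliceB a i j)
        /\ (forall y : 'cV[R]_3, matA a y = matB a y)
        /\ (conditionA a <-> conditionB a)).
Proof.
have condA := biquadratic_posdef_conditionA ha.
have condB := biquadratic_posdef_conditionB ha.
split; first by rewrite -condA -condB; split=> [|[]]; [left | |].
move=> [_ asym].
(* The entries at [k], [l] are [a i j k l] and [a k l i j], equal by the major symmetry [asym]. *)
have sliceAB i j : sliceA a i j = sliceB a i j.
  by apply/matrixP => k l; rewrite !mxE.
split=> //; split; last by rewrite -condA -condB.
by move=> y; apply/matrixP => i j; rewrite !mxE sliceAB.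
Qed.
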